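(* For all integers $k\ge 2$ and $n\ge 1$ the $k$-uniform hypergraph $K^{(k)}_{n,n}$ is obligatory; that is, every $k$-uniform hypergraph $H$ with $\chi(H)\ge\aleph_1$ contains a subhypergraph isomorphic to $K^{(k)}_{n,n}$.
   Context: For an integer $k\ge 2$, a $k$-uniform hypergraph is a pair $H=(V,E)$ where $V$ is a (finite or infinite) set of vertices and $E\subseteq\{e\subseteq V: |e|=k\}$ is its set of edges. The chromatic number $\chi(H)$ is the least cardinal $\kappa$ for which there is a colouring $f\colon V\to\kappa$ such that no edge of $H$ is monochromatic. A finite $k$-uniform hypergraph $F$ is called obligatory if every $k$-uniform hypergraph $H$ with $\chi(H)\ge\aleph_1$ has a subhypergraph isomorphic to $F$ (i.e. there is an injection of the vertices of $F$ into those of $H$ mapping edges of $F$ to edges of $H$). For a graph $F$ and an integer $k\ge 2$, the expansion $F^{(k)}$ is the $k$-uniform hypergraph obtained from $F$ by adding $k-2$ new vertices to every edge (new vertices distinct for distinct edges): it has $|V(F)|+(k-2)|E(F)|$ vertices and there is a bijection $\varphi\colon E(F)\to E(F^{(k)})$ with $e\subseteq\varphi(e)$ and $\varphi(e)\cap\varphi(e')=e\cap e'$ for all distinct $e,e'\in E(F)$. $K_{n,n}$ denotes the complete bipartite graph with $n$ vertices in each class, and $K^{(k)}_{n,n}$ its $k$-uniform expansion (so $K^{(2)}_{n,n}=K_{n,n}$). *)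

(* Defs.v *)
From mathcomp Require Import all_boot all_classical.

Set Implicit Arguments.
Unset Strict Implicit.
Unset Printing Implicit Defensive.

Local Open Scope classical_set_scope.
Local Open Scope card_scope.

(* Cardinals are represented by types, compared through injections. *)

Lemma inj_card_leT (T U : Type) (f : T -> U) :
  injective f -> [set: T] #<= [set: U].
Proof.
move=> f_inj; suff [g] : $|{injfun [set: T] >-> [set: U]}| by exact: inj_card_le g.
by apply/injfunPex; exists f => // x y _ _; exact: f_inj.
Qed.

Lemma ex_least_family (I : Type) (A : I -> Type) (i0 : I) :
  exists i, forall j, [set: A i] #<= [set: A j].
Proof.
pose X := forall i : I, A i.
pose Q (S : set X) := forall i, {in S &, injective (fun x : X => x i)}.
have [|S [QS maxS]] := @Zorn_bigcup X Q.
  move=> F FQ Ftot i x y; rewrite !inE => -[C FC Cx] [D FD Dy] exy.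
  case: (Ftot _ _ FC FD) => sub; [apply: (FQ D FD i)|apply: (FQ C FC i)] => //;
    rewrite inE //; exact: sub.
have [[i surj]|nsurj] :=
    pselect (exists i : I, forall a : A i, exists2 x, S x & x i = a).
  exists i => j; pose g a := s2val (cid2 (surj a)).
  have gS a : S (g a) by rewrite /g; case: cid2.
  have gK a : g a i = a by rewrite /g; case: cid2.
  apply: (inj_card_leT (f := fun a => g a j)) => a b eab; rewrite -(gK a) -(gK b).
  by rewrite (QS j (g a) (g b)) // inE.
have {}nsurj i : exists a : A i, forall x, S x -> x i <> a.
  apply: contrapT => na; apply: nsurj; exists i => a; apply: contrapT => nx.
  by apply: na; exists a => x Sx xa; apply: nx; exists x.
pose x0 : X := fun i => sval (cid (nsurj i)).
have x0P i x : S x -> x i <> x0 i by rewrite /x0; case: cid => a /= h; exact: h.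
exfalso; apply: (maxS (S `|` [set x0])).
  split=> [x Sx|sub]; first by left.
  by apply: (x0P i0 x0 (sub x0 _)) => //; right.
move=> i x y; rewrite !inE => -[Sx|->] [Sy|->] //.
- by apply: (QS i); rewrite inE.
- by move=> /(x0P _ _ Sx).
- by move=> /esym /(x0P _ _ Sy).
Qed.

Lemma card_leT_total (T U : Type) :
  [set: T] #<= [set: U] \/ [set: U] #<= [set: T].
Proof.
have [[] h] := ex_least_family (fun b : bool => if b then T else U) true.
- by left; exact: (h false).
- by right; exact: (h true).
Qed.

Lemma ex_least_card (P : Type -> Prop) : (exists T, P T) ->
  exists2 T, P T & forall U, P U -> [set: T] #<= [set: U].
Proof.
move=> [T0 PT0].
pose I := {S : set T0 | exists2 U : Type, P U & S #= [set: U]}.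
have I0 : I by exists [set: T0], T0.
have [[S /= [T PT ST]] leS] := ex_least_family (fun i : I => set_type (sval i)) I0.
have {}leS (S' : set T0) U : P U -> S' #= [set: U] -> [set: T] #<= [set: U].
  move=> PU SU; have SI : exists2 U : Type, P U & S' #= [set: U] by exists U.
  have /= := leS (exist _ S' SI).
  rewrite (card_le_eql (card_setT _)) (card_le_eqr (card_setT _)).
  by rewrite (card_le_eql ST) (card_le_eqr SU).
exists T => // U PU; have [UT|TU] := card_leT_total U T0.
  move/card_leP: UT => [f]; pose g u := val (f (to_setT u)).
  have g_inj : {in [set: U] &, injective g}.
    by move=> u v _ _ /val_inj /(injT (f := f)) /(congr1 val).
  exact: (leS (g @` [set: U])) PU (inj_card_eq g_inj).
exact: card_le_trans (leS [set: T0] T0 PT0 (card_eqxx _)) TU.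
Qed.

(* The least cardinal satisfying P; the value is junk when P is empty. *)
Definition least_card (P : Type -> Prop) : Type :=
  if pselect (exists T, P T) is left h
  then s2val (cid2 (ex_least_card h)) else void.

Lemma least_cardP (P : Type -> Prop) : (exists T, P T) ->
  P (least_card P) /\ forall U, P U -> [set: least_card P] #<= [set: U].
Proof. by rewrite /least_card; case: pselect => // h _; case: cid2. Qed.

Definition aleph1 : Type := least_card (fun T => ~ countable [set: T]).

Lemma aleph1P : ~ countable [set: aleph1] /\
  forall U : Type, ~ countable [set: U] -> [set: aleph1] #<= [set: U].
Proof.
apply: (least_cardP (P := fun T => ~ countable [set: T])); exists (nat -> Prop).
case/countable_injP => f f_inj.
pose D : set nat := [set n | exists2 A : set nat, f A = n & ~ A n].
have [DfD|nDfD] := pselect (D (f D)).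
  case: (DfD) => A fA nA; apply: nA; suff <- : D = A by [].
  by apply: f_inj => //; exact: mem_set.
by apply: (nDfD); exists D.
Qed.

Record hypergraph := Hypergraph {
  vertex : Type;
  edge : set (set vertex) }.
Arguments edge : clear implicits.

Definition uniform (k : nat) (H : hypergraph) :=
  forall e, edge H e -> e #= `I_k.

Definition monochromatic (V C : Type) (f : V -> C) (e : set V) :=
  exists c, forall x, e x -> f x = c.

Definition colourable (H : hypergraph) (C : Type) :=
  exists f : vertex H -> C, forall e, edge H e -> ~ monochromatic f e.

(* Meaningful as soon as all edges have at least two vertices. *)
Definition chromatic_number (H : hypergraph) : Type :=
  least_card (colourable H).

Lemma chromatic_numberP (k : nat) (H : hypergraph) :
  (2 <= k)%N -> uniform k H ->
  colourable H (chromatic_number H) /\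
  forall C, colourable H C -> [set: chromatic_number H] #<= [set: C].
Proof.
move=> k2 Hk; apply: least_cardP; exists (vertex H), id => e /Hk ek [c ec].
suff : `I_k #<= `I_1 by rewrite card_le_II leqNgt k2.
rewrite -(card_le_eql ek); apply: (@card_le_trans _ _ _ [set c]).
  exact: subset_card_le.
by have /card_eqPle[] : [set c] #= `I_1 by exact: card_set1.
Qed.

(* Not necessarily induced. *)
Definition has_subhypergraph (F H : hypergraph) :=
  exists2 f : vertex F -> vertex H, injective f &
    forall e, edge F e -> edge H (f @` e).

Definition obligatory (k : nat) (F : hypergraph) :=
  [/\ finite_set [set: vertex F], uniform k F &
      forall H, uniform k H ->
        [set: aleph1] #<= [set: chromatic_number H] -> has_subhypergraph F H].

(* The new vertices of the expansion are the pairs (e, i) with e an edge of F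
   and i < k - 2. *)
Definition expansion_vertex (k : nat) (F : hypergraph) : Type :=
  (vertex F + edge F * 'I_(k - 2))%type.

Definition expansion_edge (k : nat) (F : hypergraph) (e : edge F) :
    set (expansion_vertex k F) :=
  inl @` set_val e `|` [set inr (e, i) | i in [set: 'I_(k - 2)]].

(* F is meant to be a graph, i.e., uniform 2 F, and 2 <= k. *)
Definition expansion (k : nat) (F : hypergraph) : hypergraph :=
  @Hypergraph (expansion_vertex k F) (range (@expansion_edge k F)).

Definition complete_bipartite (n : nat) : hypergraph :=
  @Hypergraph ('I_n + 'I_n)%type
    [set e | exists i j : 'I_n, e = [set inl i; inr j]].

Lemma set_val_inj (V : Type) (A : set V) : injective (set_val : A -> V).
Proof. by move=> x y /val_inj. Qed.

(* The bijection e |-> expansion_edge e has the properties that characterise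
   the expansion of a graph. *)
Lemma expansion_edge_base (k : nat) (F : hypergraph) (e : edge F) (x : vertex F) :
  @expansion_edge k F e (inl x) <-> set_val e x.
Proof.
split; first by case=> [[y ey [<-]]|[]].
by left; exists x.
Qed.

Lemma expansion_edge_new (k : nat) (F : hypergraph) (e e' : edge F) i :
  @expansion_edge k F e (inr (e', i)) <-> e' = e.
Proof.
split; first by case=> [[]|[j _ [->]]].
by move=> ->; right; exists i.
Qed.

Lemma expansion_edge_inj (k : nat) (F : hypergraph) :
  injective (@expansion_edge k F).
Proof.
move=> e e' ee'; apply: set_val_inj; apply/seteqP; split=> x ex.
  by apply/(@expansion_edge_base k); rewrite -ee'; apply/expansion_edge_base.
by apply/(@expansion_edge_base k); rewrite ee'; apply/expansion_edge_base.
Qed.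

Lemma expansion_edgeI (k : nat) (F : hypergraph) (e e' : edge F) : e <> e' ->
  @expansion_edge k F e `&` expansion_edge e' =
  inl @` (set_val e `&` set_val e').
Proof.
move=> ee'; apply/seteqP; split=> [[x|[d i]] []|_ [x [ex e'x] <-]].
- by move=> /expansion_edge_base ex /expansion_edge_base e'x; exists x.
- by move=> /expansion_edge_new -> /expansion_edge_new /ee'.
- by split; apply/expansion_edge_base.
Qed.

Lemma card_eqU (V : Type) (A B : set V) (m n : nat) : A `&` B = set0 ->
  A #= `I_m -> B #= `I_n -> A `|` B #= `I_(m + n).
Proof.
move=> AB0 Am Bn; pose V' := {classic V}.
pose A' : set V' := A; pose B' : set V' := B.
have fA : finite_set A' by exists m.
have fB : finite_set B' by exists n.
suff : (A' `|` B') #= `I_(m + n) by [].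
have fAB : finite_set (A' `|` B') by rewrite finite_setU.
rewrite -(fset_setK fAB); apply/card_eq_fsetP.
rewrite fset_setU // finmap.cardfsU -fset_setI // [A' `&` B']AB0 fset_set0 finmap.cardfs0 subn0.
by rewrite (card_fset_set (A := A') Am) (card_fset_set (A := B') Bn).
Qed.

Lemma expansion_uniform (k : nat) (F : hypergraph) :
  (2 <= k)%N -> uniform 2 F -> uniform k (expansion k F).
Proof.
move=> k2 F2 _ [e _ <-]; rewrite -[X in `I_X](subnKC k2); apply: card_eqU.
- by rewrite -subset0 => _ [[x _ <-] []].
- rewrite (card_eql (inj_card_eq _)); last by move=> x y _ _ [].
  by apply: F2; exact: set_valP.
- rewrite (card_eql (inj_card_eq _)); last by move=> x y _ _ [].
  by rewrite card_eq_sym card_II.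
Qed.

Lemma complete_bipartite_uniform (n : nat) : uniform 2 (complete_bipartite n).
Proof.
move=> _ [i [j ->]]; apply: (card_eqU (m := 1) (n := 1)); rewrite ?card_set1 //.
by rewrite -subset0 => _ [->].
Qed.

(* Main.v *)
(* Idea. Sets of vertices are exhausted by an increasing chain of sets closed
   under a finitary operation, and a colouring is glued from colourings of the
   layers of the chain. For graphs the operation adds the finitely many common
   neighbours of each n-set, so that a vertex has fewer than n neighbours in the
   earlier layers; list colourings with finite lists of forbidden colours can
   then be extended layer by layer (Erdos-Hajnal).

   For k >= 3 use induction on k. Call a set of vertices rich when no L vertices
   outside it meet all the edges that contain it. A K_{n,n} expansion made of
   rich j-sets extends greedily to one made of edges, so for 2 <= j < k the rich
   j-sets are countably colourable by induction, and it remains to colour the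
   edges without rich subsets of these sizes. With chains closed under the
   L-sets witnessing non-richness, such an edge has at most one vertex below its
   top layer. If it has none, a colouring of the layer takes care of it. If it
   has one, x, its other k - 1 vertices form an edge of a trace hypergraph on
   the layer; a large K_{m,m} expansion of traces, each edge labelled by its x,
   repeats a label at most L times around a vertex, so it contains an n by n
   rainbow subgrid, which gives a K_{n,n} expansion in the original hypergraph.
   Hence the trace hypergraph is countably colourable by induction. *)
Require Import Defs.
From mathcomp Require Import all_boot.
From mathcomp Require Import all_classical finmap.
From mathcomp.classical Require Import wochoice.

Set Implicit Arguments.
Unset Strict Implicit.
Unset Printing Implicit Defensive.

(** * Independent sets and rainbow grids *)

(** Greedy choice: picking [x] discards at most [d] elements, among them [x] itself because [r] is
    reflexive. *)
Lemma ex_independent (T : finType) (A : {set T}) (r : rel T) d n :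
  reflexive r -> symmetric r -> 0 < d ->
  (forall x, x \in A -> #|[set y in A | r x y]| <= d) -> n * d <= #|A| ->
  exists f : 'I_n -> T, (forall i, f i \in A) /\ forall i j, r (f i) (f j) -> i = j.
Proof.
move=> rxx rC d0 rd; suff ex (B : {set T}) : B \subset A -> n * d <= #|B| -> exists s : seq T,
    [/\ size s = n, {subset s <= B} & pairwise (fun x y => ~~ r x y) s].
  move=> /(ex A (fintype.subxx _))[s [/eqP sn sA s_r]].
  exists (tnth (Tuple sn)); split=> [i|i j]; first by apply: sA; exact: mem_tnth.
  case: n => [|n'] in ex sn i j *; first by case: i.
  have x0 := tnth (Tuple sn) i; move/(pairwiseP x0): s_r => s_r; rewrite !(tnth_nth x0) /= => rij.
  have lt u : (u : 'I_n'.+1) < size s by rewrite (eqP sn).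
  case: (ltngtP i j) => [ij|ji|/val_inj//].
    by have := s_r i j (lt i) (lt j) ij; rewrite rij.
  by have := s_r j i (lt j) (lt i) ji; rewrite rC rij.
elim: n B => [|n IH] B BA nB; first by exists [::].
have [x xB] : exists x, x \in B by apply/card_gt0P; apply: leq_trans nB; rewrite mulSn addn_gt0 d0.
have xA := fintype.subsetP BA x xB.
have [||s [sn sB s_r]] := IH [set y in B | ~~ r x y].
- by apply: fintype.subset_trans BA; apply/fintype.subsetP => y; rewrite inE => /andP[].
- rewrite -(leq_add2l d) -mulSn; apply: leq_trans nB _.
  rewrite -(cardsID [set y | r x y] B) leq_add //.
    apply: leq_trans (rd x xA); apply: subset_leq_card; apply/fintype.subsetP => y.
    by rewrite !inE => /andP[/(fintype.subsetP BA)-> ->].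
  by apply: subset_leq_card; apply/fintype.subsetP => y; rewrite !inE andbC.
exists (x :: s); split; first by rewrite /= sn.
  by move=> y; rewrite inE => /orP[/eqP->//|/sB]; rewrite inE => /andP[].
by rewrite /= s_r andbT; apply/allP => y /sB; rewrite inE => /andP[].
Qed.

Lemma pigeonhole (S T : finType) (h : S -> T) d : d * #|T| < #|S| ->
  exists t, d <= #|[set x | h x == t]|.
Proof.
move=> dTS; apply/existsP; apply: contraLR dTS; rewrite negb_exists -leqNgt => /forallP small.
rewrite -sum1_card (partition_big h predT) //= mulnC -sum_nat_const leq_sum // => t _.
rewrite sum1dep_card ltnW // ltnNge; exact: small.
Qed.

(** Each column has [n] rows with distinct labels. By pigeonhole many columns share the same choice
    of rows, and among these [n] columns are picked greedily so that no two share a label on the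
    chosen rows. *)
Lemma ex_rainbow_grid n L : exists m M, forall (V : eqType) (chi : 'I_m -> 'I_M -> V),
  (forall i x, #|[set j | chi i j == x]| <= L) ->
  (forall j x, #|[set i | chi i j == x]| <= L) ->
  exists (f : 'I_n -> 'I_m) (g : 'I_n -> 'I_M),
    forall i j i' j', chi (f i) (g j) = chi (f i') (g j') -> i = i' /\ j = j'.
Proof.
have [->|n0] := posnP n.
  exists 0, 0 => V chi _ _; exists id, id; case=> //.
(* On [n] fixed rows a column shares a label with at most [n * n * L] columns: one of its [n] labels
   recurs in one of the [n] rows. The successor of [L] keeps the bounds positive when [L = 0]. *)
pose m := n * L.+1; pose d := n * n * L.+1.
exists m, ((n * d) * #|{ffun 'I_n -> 'I_m}|).+1 => V chi row_le col_le.
have colP j : exists f : {ffun 'I_n -> 'I_m}, forall i i', chi (f i) j = chi (f i') j -> i = i'.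
  have [|||i _||f [_ fP]] := @ex_independent _ [set: 'I_m] (fun i i' => chi i j == chi i' j) L.+1 n.
  - by move=> i; exact: eqxx.
  - by move=> i i'; exact: eq_sym.
  - by [].
  - apply: leqW; apply: leq_trans (col_le j (chi i j)); apply: subset_leq_card.
    by apply/fintype.subsetP => i'; rewrite !inE eq_sym.
  - by rewrite cardsT card_ord.
  by exists [ffun i => f i] => i i'; rewrite !ffunE => /eqP/fP.
have [fc fcP] := fin_all_exists colP.
have [|f f_fib] := @pigeonhole _ _ fc (n * d); first by rewrite card_ord.
pose A := [set j | fc j == f].
pose r j j' := [exists i, exists i', chi (f i) j == chi (f i') j'].
have d0 : 0 < d by rewrite /d !muln_gt0 n0.
have [|||j _|//|g [gA gP]] := @ex_independent _ A r d n.
- by move=> j; apply/existsP; exists (Ordinal n0); apply/existsP; exists (Ordinal n0).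
- move=> j j'; apply/idP/idP => /existsP[i /existsP[i' /eqP e]];
    by apply/existsP; exists i'; apply/existsP; exists i; rewrite e.
- by [].
- have sub : [set j' in A | r j j'] \subset
      \bigcup_(p : 'I_n * 'I_n) [set j' | chi (f p.2) j' == chi (f p.1) j].
    apply/fintype.subsetP => j'; rewrite inE => /andP[_ /existsP[i /existsP[i' /eqP e]]].
    by apply/finset.bigcupP; exists (i, i') => //; rewrite inE e.
  apply: leq_trans (subset_leq_card sub) _.
  apply: (@leq_trans (\sum_(p : 'I_n * 'I_n) L.+1)); last first.
    by rewrite sum_nat_const card_prod card_ord.
  elim/big_ind2: _ => [|B b C c Bb Cc|p _]; first by rewrite cards0.
    exact: leq_trans (leq_card_setU _ _) (leq_add Bb Cc).
  exact/leqW/row_le.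
exists f, g => i j i' j' e.
have jj' : j = j' by apply: gP; apply/existsP; exists i; apply/existsP; exists i'; rewrite e.
split=> //; move: e; rewrite jj'; move/(_ j'): gA; rewrite inE => /eqP <-; exact: fcP.
Qed.

Local Open Scope fset_scope.
Local Open Scope classical_set_scope.
Local Open Scope card_scope.

(** * Induction along filtrations by closed sets *)

Section Filtration.
Variables (V : choiceType) (F : {fset V} -> seq V).

(** The witness [y] restricts the condition to nonempty [s], so that the empty part below a least
    layer counts as closed. *)
Definition closed_under (D : set V) :=
  forall s y, y \in s -> (forall z, z \in s -> D z) -> forall x, x \in F s -> D x.

Inductive hull (A : set V) : V -> Prop :=
| hull_base x : A x -> hull A x
| hull_step s x y : y \in s -> (forall z, z \in s -> hull A z) -> x \in F s -> hull A x.

Lemma hull_closed A : closed_under (hull A).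
Proof. by move=> s y ys sA x; exact: hull_step ys sA. Qed.

Lemma hull_least A D : closed_under D -> A `<=` D -> hull A `<=` D.
Proof.
move=> clD AD x; elim=> {x} [x /AD //|s x y ys _ IH xF].
exact: clD ys IH x xF.
Qed.

Lemma hullS A B : A `<=` B -> hull A `<=` hull B.
Proof.
by move=> AB; apply: hull_least => [|x /AB]; [exact: hull_closed|exact: hull_base].
Qed.

(* The hull consists of the values of the finite terms over [nat]. *)
Lemma hull_countable (a : nat -> V) : countable (hull (range a)).
Proof.
pose fix eval (t : GenTree.tree nat) : V :=
  match t with
  | GenTree.Leaf m => a m
  | GenTree.Node m ts => nth (a 0) (F [fset x in map eval ts]) m
  end.
suff sub : hull (range a) `<=` range eval.
  by apply: sub_countable (card_le_trans (subset_card_le sub) (card_image_le _ _)) _;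
    exact: countableP.
apply: hull_least => [s y ys sD x xF|_ [m _ <-]]; last by exists (GenTree.Leaf m).
have [ts tsE] : exists ts, map eval ts = enum_fset s.
  elim: (enum_fset s) (sD : forall z, z \in enum_fset s -> _) => [|z l IH] lD.
    by exists [::].
  have [t _ <-] := lD z (mem_head _ _).
  have [ts <-] := IH (fun u ul => lD u (mem_behead (s := z :: l) ul)).
  by exists (t :: ts).
exists (GenTree.Node (index x (F s)) ts) => //=.
have -> : [fset u in map eval ts] = s by apply/fsetP => u; rewrite !inE tsE.
exact: nth_index.
Qed.

End Filtration.

Section WellOrder.
Variables (V : choiceType).

Definition strict_well_order (lt : V -> V -> Prop) :=
  [/\ well_founded lt, (forall x y z, lt x y -> lt y z -> lt x z) &
      forall x y, [\/ lt x y, x = y | lt y x]].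

Lemma ex_strict_well_order : exists lt, strict_well_order lt.
Proof.
have [R Rwo] := well_ordering_principle V.
have Rmin (A : {pred V}) : nonempty A -> exists2 m, m \in A & {in A, forall x, R m x}.
  by move=> /Rwo[m [[Am Rm] _]]; exists m.
have RC : wo_chain R predT by move=> A _; exact: Rwo.
have Rtot x y : ~~ R x y -> R y x
  by have /orP[->|] := wo_chainW RC
    (isT : x \in predT) (isT : y \in predT).
have Ranti x y : R x y -> R y x -> x = y.
  by move=> xy yx; apply: (wo_chain_antisymmetric RC) => //; rewrite xy.
exists (fun x y => ~~ R y x); split.
- move=> x; apply: contrapT => nx.
  have [m] := Rmin (fun x => `[< ~ Acc (fun x y => ~~ R y x) x >]) (ex_intro _ x (asboolT nx)).
  move=> /asboolP nm mmin; apply: nm; constructor=> y ny; apply: contrapT => nAy.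
  by move/negP: ny; apply; apply: mmin; exact/asboolP.
- move=> x y z nyx nzy; apply/negP => Rzx.
  have [m + mmin] := Rmin (mem [:: x; y; z]) (ex_intro _ x (mem_head _ _)).
  have [Rmx Rmy Rmz] : [/\ R m x, R m y & R m z] by split; apply: mmin; rewrite !inE eqxx ?orbT.
  rewrite !inE => /or3P[]/eqP mE; move: Rmx Rmy Rmz; rewrite mE.
  + by move=> _ _ Rxz; move: nyx; rewrite (Ranti _ _ Rxz Rzx) (Rtot _ _ nzy).
  + by rewrite (negbTE nyx).
  + by rewrite (negbTE nzy).
- move=> x y; case: (boolP (R y x)) => [yx|]; last by constructor 1.
  case: (boolP (R x y)) => [xy|]; last by constructor 3.
  by constructor 2; exact: Ranti.
Qed.

Lemma strict_well_order_irr lt x : strict_well_order lt -> ~ lt x x.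
Proof. by move=> [wf _ _]; move: x; apply: (well_founded_ind wf) => x IH ltxx; exact: (IH x). Qed.

Lemma strict_well_order_max lt (T : eqType) (f : T -> V) (s : seq T) y :
  strict_well_order lt -> y \in s ->
  exists2 m, m \in s & forall z, z \in s -> ~ lt (f m) (f z).
Proof.
move=> lt_wo; have [_ tr _] := lt_wo.
elim: s y => [//|x s IH] y _; case: s IH => [_|u s IH].
  exists x; first exact: mem_head.
  by move=> z; rewrite inE => /eqP->; exact: strict_well_order_irr.
have [m ms mmax] := IH u (mem_head _ _).
have [mx|nmx] := pselect (lt (f m) (f x)).
  exists x; first exact: mem_head.
  move=> z; rewrite inE => /orP[/eqP->|/mmax nmz xz]; first exact: strict_well_order_irr.
  by apply: nmz; exact: tr mx xz.
exists m; first by rewrite inE ms orbT.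
by move=> z; rewrite inE => /orP[/eqP->|/mmax].
Qed.
End WellOrder.

Lemma well_founded_least (V : Type) (lt : V -> V -> Prop) (P : V -> Prop) :
  well_founded lt -> (exists x, P x) ->
  exists2 x, P x & forall y, lt y x -> ~ P y.
Proof.
move=> wf [x Px]; apply: contrapT => no; move: Px.
elim/(well_founded_ind wf): x => x IH Px; apply: no; exists x => // y /IH; exact.
Qed.

Section FiltrationInduction.
Variables (V : choiceType) (F : {fset V} -> seq V) (Good : set V -> Prop).

Hypothesis Good_countable : forall W : set V, countable W -> Good W.
(** The layers of [W] are the fibres of [rho], indexed by elements of [V] itself. *)
Hypothesis Good_chain : forall lt (W : set V) (rho : V -> V), strict_well_order lt ->
  (forall i, closed_under F [set x | W x /\ lt (rho x) i]) ->
  (forall i, W i -> Good [set x | W x /\ ~ lt (rho i) (rho x)]) ->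
  Good W.

(** The hull is the union of the increasing sets [B i], and the layer of a point is the least [i] in
    [A] such that [B i] contains it. Finitely many points from layers below [i] lie in a single
    [B j] with [j] below [i], so these layers together are closed; the layers up to [rho i] make up
    [B (rho i)]. *)
Lemma Good_hullU lt (A : set V) (a : nat -> V) : strict_well_order lt ->
  (exists i, A i) -> (forall i j, lt i j -> A j -> A i) ->
  (forall i, A i -> Good (hull F (range a `|` [set j | ~ lt i j]))) ->
  Good (hull F (range a `|` A)).
Proof.
move=> lt_wo [i0 Ai0] A_down A_good; have [wf tr tri] := lt_wo.
pose B i := hull F (range a `|` [set j | ~ lt i j]).
have Bmono i j : ~ lt j i -> B i `<=` B j.
  move=> nji; apply: hullS => x [|nix]; first by left.
  right=> jx; case: (tri i j) => [ij||//]; first by exact: nix (tr _ _ _ ij jx).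
  by move=> ij; apply: nix; rewrite ij.
have BA i : A i -> B i `<=` hull F (range a `|` A).
  move=> Ai; apply: hullS => x [|nix]; [by left|right].
  by case: (tri x i) => [xi||//]; [exact: A_down xi Ai|move->].
have rhoP x : exists i, hull F (range a `|` A) x ->
    [/\ A i, B i x & forall j, lt j i -> ~ (A j /\ B j x)].
  have [Wx|nWx] := pselect (hull F (range a `|` A) x); last by exists x.
  suff : exists i, A i /\ B i x.
    by move=> /(well_founded_least wf)[i [Ai Bi] imin]; exists i.
  elim: Wx => {x} [x [ax|Ax]|s x y ys _ IH xF].
  - by exists i0; split=> //; apply: hull_base; left.
  - by exists x; split=> //; apply: hull_base; right; exact: strict_well_order_irr.
  - pose f z := if pselect (exists i, A i /\ B i z) is left h then sval (cid h) else z.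
    have fP z : z \in s -> A (f z) /\ B (f z) z.
      by rewrite /f; case: pselect => [h _|+ zs]; [case: cid|case; exact: IH].
    (* The set [B] at the largest index occurring in [s] contains all of [s], hence also [x]. *)
    have [m ms mmax] := strict_well_order_max f lt_wo ys.
    exists (f m); split; first exact: (fP m ms).1.
    by apply: hull_step ys _ xF => z zs; exact: Bmono (mmax z zs) _ (fP z zs).2.
pose rho x := sval (cid (rhoP x)).
have rho_spec x : hull F (range a `|` A) x ->
    [/\ A (rho x), B (rho x) x & forall j, lt j (rho x) -> ~ (A j /\ B j x)].
  by rewrite /rho; case: cid.
have rho_le i x : A i -> B i x -> ~ lt i (rho x).
  by move=> Ai Bix ix; have [_ _ /(_ _ ix)] := rho_spec x (BA _ Ai _ Bix); apply.
apply: (Good_chain (rho := rho) lt_wo) => [i s y ys sD x xF|i Wi].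
  suff [j [ji Aj] Bj] : exists2 j, lt j i /\ A j & forall z, z \in s -> B j z.
    have Bx : B j x by exact: hull_step ys Bj xF.
    split; first exact: BA Bx.
    have := rho_le _ _ Aj Bx; case: (tri j (rho x)) => [//|<-//|xj _]; exact: tr xj ji.
  have [m ms mmax] := strict_well_order_max rho lt_wo ys.
  have [Wm mi] := sD m ms; have [Am _ _] := rho_spec m Wm.
  exists (rho m) => // z zs; have [Wz _] := sD z zs; have [_ Bz _] := rho_spec z Wz.
  exact: Bmono (mmax z zs) _ Bz.
have [Ai Bi _] := rho_spec i Wi.
suff -> : [set x | hull F (range a `|` A) x /\ ~ lt (rho i) (rho x)] = B (rho i).
  exact: A_good.
apply/seteqP; split=> x /=.
  by move=> [Wx nix]; have [_ Bx _] := rho_spec x Wx; exact: Bmono Bx.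
by move=> Bx; split; [exact: BA Bx|exact: rho_le].
Qed.

(* The countable set [range a] absorbs the last element of a closed initial
   segment, which makes the induction run along an arbitrary well-order, without
   any cardinal arithmetic. *)
Lemma filtration_induction : Good setT.
Proof.
have [[x0]|V0] := pselect (inhabited V); last first.
  apply: Good_countable; suff -> : setT = set0 :> set V by exact: countable0.
  by apply/seteqP; split=> // x; case: V0.
have [lt lt_wo] := ex_strict_well_order V; have [wf tr tri] := lt_wo.
have le_good i : (forall a : nat -> V, Good (hull F (range a `|` [set j | lt j i]))) ->
    forall a : nat -> V, Good (hull F (range a `|` [set j | ~ lt i j])).
  move=> good a; pose a' m := if m is m'.+1 then a m' else i.
  suff -> : range a `|` [set j | ~ lt i j] = range a' `|` [set j | lt j i] by exact: good.
  apply/seteqP; split=> x /=.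
    move=> [[m _ <-]|nix]; first by left; exists m.+1.
    by case: (tri x i) => [|->|//]; [right|left; exists 0].
  move=> [[[|m] _ <-]|xi]; first by right; exact: strict_well_order_irr.
    by left; exists m.
  by right => ix; exact: strict_well_order_irr lt_wo (tr _ _ _ ix xi).
suff good i (a : nat -> V) : Good (hull F (range a `|` [set j | lt j i])).
  have -> : setT = hull F (range (fun _ : nat => x0) `|` setT).
    by apply/seteqP; split=> // x _; apply: hull_base; right.
  apply: Good_hullU lt_wo _ _ _ => //; first by exists x0.
  by move=> i _; apply: le_good => b; exact: good.
elim/(well_founded_ind wf): i a => i IH a.
have [[j ji]|imin] := pselect (exists j, lt j i); last first.
  have -> : [set j | lt j i] = set0 by apply/seteqP; split=> // j ji; apply: imin; exists j.
  by rewrite setU0; apply: Good_countable; exact: hull_countable.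
apply: Good_hullU lt_wo _ _ _ => [|j' j''|j' ji']; first by exists j.
  exact: tr.
by apply: le_good; exact: IH.
Qed.
End FiltrationInduction.

(** * Graphs *)

(** [G] receives a total function, with the junk value [x0] away from the predecessors, and so takes
    no proof arguments. *)
Lemma well_founded_recursion (I X : Type) (lt : I -> I -> Prop) (x0 : X)
    (G : I -> (I -> X) -> X) : well_founded lt ->
  exists c : I -> X, forall i, c i = G i (fun j => if `[< lt j i >] then c j else x0).
Proof.
move=> wf.
pose step i (rec : forall j, lt j i -> X) :=
  G i (fun j => if pselect (lt j i) is left h then rec j h else x0).
exists (Fix wf (fun=> X) step) => i; rewrite Fix_eq.
  congr G; apply/funext => j; case: pselect => [ji|nji].
    by rewrite (asboolT ji).
  by rewrite (asboolF nji).
move=> {}i f g fg; congr G; apply/funext => j; by case: pselect.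
Qed.

Lemma uniq_seq_or_cover (V : eqType) (P : set V) n :
  (exists s : seq V, [/\ size s = n, uniq s & forall x, x \in s -> P x]) \/
  (exists l : seq V, forall x, P x -> x \in l).
Proof.
elim: n => [|n [[s [sn us sP]]|[l lP]]]; [by left; exists [::]| |by right; exists l].
have [lP|] := pselect (forall x, P x -> x \in s); first by right; exists s.
move=> /existsNP[x /not_implyP[Px /negP xs]]; left; exists (x :: s); split=> /=.
- by rewrite sn.
- by rewrite xs.
- by move=> y; rewrite inE => /orP[/eqP->|/sP].
Qed.

Lemma ex_enum_uniq (V : eqType) (s : seq V) n : uniq s -> size s = n ->
  exists a : 'I_n -> V, [/\ injective a, forall i, a i \in s &
    forall x, x \in s -> exists i, a i = x].
Proof.
move=> us /eqP sn; exists (tnth (Tuple sn)); split=> [|i|x xs]; first exact/tuple_uniqP.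
  exact: mem_tnth.
by have /tnthP[i xi] : x \in Tuple sn by []; exists i.
Qed.

Lemma cardfs2_ex (V : choiceType) (e : {fset V}) : #|` e| = 2 -> exists x y, e = [fset x; y].
Proof.
move=> e2; have [x xe] : exists x, x \in e by apply/fset0Pn; rewrite -cardfs_gt0 e2.
have /cardfs1P[y ey] : #|` (e `\ x)%fset| == 1 by move: e2; rewrite (cardfsD1 x) xe add1n => -[->].
by exists x, y; rewrite -[LHS](fsetD1K xe) ey.
Qed.

Section BipartiteExpansions.
Variable V : choiceType.
Implicit Types E : set {fset V}.

Definition nat_colourable E :=
  exists c : V -> nat, forall e, E e -> ~ monochromatic c [set` e].

(* [a] and [b] are injective with disjoint ranges, and the sets [g i j] minus
   [a i] and [b j] are disjoint from each other and from both ranges; when [E] is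
   k-uniform this is a copy of the k-uniform expansion of K_{n,n}. *)
Definition bip_exp n E := exists (a b : 'I_n -> V) (g : 'I_n -> 'I_n -> {fset V}),
  (forall i j, [/\ E (g i j), a i \in g i j, b j \in g i j & a i != b j]) /\
  (forall i j i' j' x, x \in g i j -> x \in g i' j' ->
    [\/ i = i' /\ j = j', i = i' /\ x = a i | j = j' /\ x = b j]).

End BipartiteExpansions.

Section Graph.
Variables (V : choiceType) (E : set {fset V}) (n : nat).
Hypothesis E2 : forall e, E e -> #|` e| = 2.
Hypothesis nbip : ~ bip_exp n E.

Let common (s : {fset V}) : set V := [set z | forall y, y \in s -> E [fset y; z]].

Lemma adj_neq x y : E [fset x; y] -> x != y.
Proof. by move/E2; rewrite cardfs2; case: eqP. Qed.

(** An [n]-set with [n] distinct common neighbours would span a complete bipartite graph. *)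
Lemma common_cover (s : {fset V}) : exists l : seq V, #|` s| = n ->
  forall z, common s z -> z \in l.
Proof.
have [sn|] := pselect (#|` s| = n); last by exists [::].
have [[t [tn ut tP]]|[l lP]] := uniq_seq_or_cover (common s) n; last by exists l.
exfalso; apply: nbip.
have [a [a_inj aP _]] := ex_enum_uniq (fset_uniq s) sn.
have [b [b_inj bP _]] := ex_enum_uniq ut tn.
have ab i j : E [fset a i; b j] by exact: (tP _ (bP j)).
have abN i j : a i != b j by exact: adj_neq.
exists a, b, (fun i j => [fset a i; b j]); split=> [i j|i j i' j' x].
  by rewrite !inE !eqxx orbT.
rewrite !inE => /orP[]/eqP-> /orP[]/eqP xE; last by constructor 3; move/b_inj: xE.
- by constructor 2; move/a_inj: xE.
- by have := abN i j'; rewrite xE eqxx.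
- by have := abN i' j; rewrite xE eqxx.
Qed.

Let F (s : {fset V}) : seq V := sval (cid (common_cover s)).

(* The finite sets [B x] of forbidden colours are what makes the induction go
   through: they record the colours of the neighbours in earlier layers. *)
Let list_colourable (W : set V) := forall B : V -> seq nat, exists c : V -> nat,
  (forall x, W x -> c x \notin B x) /\
  (forall x y, W x -> W y -> E [fset x; y] -> c x != c y).

Lemma graph_colourable : (1 <= n)%N -> nat_colourable E.
Proof.
move=> n1.
suff /(_ (fun=> [::]))[c [_ cP]] : list_colourable setT.
  exists c => e Ee [m cm].
  have [x [y eE]] := cardfs2_ex (E2 Ee).
  have := cP x y I I; rewrite -eE => /(_ Ee).
  by rewrite !cm ?eqxx //= eE !inE eqxx ?orbT.
apply: (filtration_induction (F := F)) => [W|].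
  move=> /countable_injP[h h_inj] B.
  (* Colours coded from distinct values of [h] never agree, and each vertex has infinitely many
     codes, one of which avoids the finite list [B x]. *)
  pose code (p m : nat) := choice.pickle (p, m).
  have free x : exists m : nat, code (h x) m \notin B x.
    apply: contrapT => /forallNP full.
    have sub : {subset map (code (h x)) (iota 0 (size (B x)).+1) <= B x}.
      by move=> _ /mapP[m _ ->]; apply: contrapT => /negP; exact: full.
    have u : uniq (map (code (h x)) (iota 0 (size (B x)).+1)).
      by rewrite map_inj_uniq ?iota_uniq // => m m' /(pcan_inj choice.pickleK)[].
    by have := uniq_leq_size u sub; rewrite size_map size_iota ltnn.
  exists (fun x => code (h x) (sval (cid (free x)))); split.
    by move=> x _; case: cid.
  move=> x y Wx Wy /adj_neq xy; apply: contra xy => /eqP /(pcan_inj choice.pickleK)[hxy _].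
  by apply/eqP; apply: h_inj => //; exact/mem_set.
move=> lt W rho lt_wo rho_closed rho_good B; have [wf tr tri] := lt_wo.
(* If [x] had [n] neighbours in earlier layers, closedness of the part below [rho x] would put their
   common neighbour [x] below its own layer. *)
have nbP x : exists l : seq V, W x -> forall y, W y ->
    lt (rho y) (rho x) -> E [fset y; x] -> y \in l.
  have [Wx|] := pselect (W x); last by exists [::].
  have [[t [tn ut tP]]|[l lP]] := uniq_seq_or_cover
      [set y | [/\ W y, lt (rho y) (rho x) & E [fset y; x]]] n; last first.
    by exists l => _ y Wy yx Exy; exact: lP.
  exfalso; have [y yt] : exists y, y \in t.
    by case: t tn {ut tP} => [|y t] tn; [move: n1; rewrite -tn|exists y; exact: mem_head].
  suff [_] : W x /\ lt (rho x) (rho x) by exact: strict_well_order_irr.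
  apply: (rho_closed (rho x) [fset z in t] y).
  - by rewrite !inE.
  - by move=> z; rewrite !inE => zt; have [] := tP z zt.
  - rewrite /F; case: cid => l /= lP; apply: lP.
      by rewrite card_fseq undup_id.
    by move=> z; rewrite !inE => zt; have [] := tP z zt.
pose nb x := sval (cid (nbP x)).
(* The colouring of a layer is chosen as a function of the lists, since the recursion determines
   these only later. *)
have layerP i : exists c : (V -> seq nat) -> V -> nat, forall B', (exists2 j, W j & rho j = i) ->
    (forall x, W x -> rho x = i -> c B' x \notin B' x) /\
    (forall x y, W x -> W y -> rho x = i -> rho y = i -> E [fset x; y] -> c B' x != c B' y).
  have [[j Wj <-]|] := pselect (exists2 j, W j & rho j = i); last by exists (fun _ _ => 0).
  exists (fun B' => sval (cid (rho_good j Wj B'))) => B' _; case: cid => c /= [cB cE].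
  have irr := @strict_well_order_irr _ lt _ lt_wo.
  split=> [x Wx xj|x y Wx Wy xj yj]; first by apply: cB; rewrite xj.
  by apply: cE; rewrite ?xj ?yj.
(* [c i] colours all of [V] but matters on layer [i] only; the final colouring is the diagonal one.
   The lists grow by the colours of the earlier neighbours. *)
have [c cE] := well_founded_recursion (fun=> 0) (fun i rec =>
  sval (cid (layerP i)) (fun z => B z ++ [seq rec (rho y) y | y <- nb z])) wf.
have layer x Wx := svalP (cid (layerP (rho x))) (fun z => B z ++
   [seq (if `[< lt (rho y) (rho x) >] then c (rho y) else fun=> 0) y | y <- nb z])
   (ex_intro2 _ _ x Wx erefl).
have nbE x y : W x -> W y -> lt (rho y) (rho x) -> E [fset y; x] -> c (rho x) x != c (rho y) y.
  move=> Wx Wy yx Eyx; have [/(_ x Wx erefl) + _] := layer x Wx; rewrite -cE mem_cat.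
  apply: contra => /eqP->; apply/orP; right; apply/mapP; exists y.
    by rewrite /nb; case: cid => l; apply.
  by rewrite (asboolT yx).
exists (fun x => c (rho x) x); split=> [x Wx|x y Wx Wy Exy].
  by have [/(_ x Wx erefl) + _] := layer x Wx; rewrite -cE mem_cat negb_or => /andP[].
case: (tri (rho x) (rho y)) => [xy|xy|yx].
- by rewrite eq_sym; exact: nbE.
- have [_ /(_ x y Wx Wy erefl (esym xy) Exy)] := layer x Wx.
  by rewrite -cE -xy.
- by apply: nbE => //; rewrite fsetUC.
Qed.
End Graph.

(** * Rich sets and traces *)

Lemma size_flatten_leq (T : Type) (ss : seq (seq T)) k :
  all (fun s => size s <= k) ss -> size (flatten ss) <= size ss * k.
Proof.
elim: ss => //= s ss IH /andP[sk /IH ssk].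
by rewrite size_cat mulSn leq_add.
Qed.

Section Colourings.
Variable V : choiceType.
Implicit Types E : set {fset V}.

Lemma nat_colourable_refine E E' :
  (forall e, E e -> exists2 e', E' e' & (e' `<=` e)%fset) ->
  nat_colourable E' -> nat_colourable E.
Proof.
move=> EE' [c cP]; exists c => e /EE'[e' /cP + /fsubsetP e'e] [m cm].
by apply; exists m => x /e'e; exact: cm.
Qed.

Lemma monochromatic_code (c c' : V -> nat) (A : set V) :
  monochromatic (fun x => choice.pickle (c x, c' x)) A ->
  monochromatic c A /\ monochromatic c' A.
Proof.
move=> [m cm]; have [[p q]|noA] := pselect (exists x, A x).
  split; [exists (c p)|exists (c' p)] => x Ax;
    by have [] := (pcan_inj choice.pickleK (etrans (cm x Ax) (esym (cm p q)))).
by split; exists 0 => x Ax; case: noA; exists x.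
Qed.

Lemma nat_colourableU E E' : nat_colourable E -> nat_colourable E' ->
  nat_colourable (E `|` E').
Proof.
move=> [c cP] [c' c'P]; exists (fun x => choice.pickle (c x, c' x)) => e Ee.
by move=> /monochromatic_code[m m']; case: Ee => [/cP|/c'P].
Qed.

End Colourings.

Section Rich.
Variables (V : choiceType) (E : set {fset V}) (L : nat).

Definition rich (s : {fset V}) := forall F : seq V, size F <= L ->
  (forall x, x \in F -> x \notin s) ->
  exists e, [/\ E e, (s `<=` e)%fset & forall x, x \in F -> x \notin e].

Lemma not_rich s : ~ rich s -> exists F : seq V, [/\ size F <= L,
  forall x, x \in F -> x \notin s &
  forall e, E e -> (s `<=` e)%fset -> exists2 x, x \in F & x \in e].
Proof.
move=> /existsNP[F /not_implyP[FL /not_implyP[Fs no]]]; exists F; split=> // e Ee se.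
apply: contrapT => noF; apply: no; exists e; split=> // x xF; apply/negP => xe.
by apply: noF; exists x.
Qed.

(** The edges are chosen one at a time. The edge over [s p] avoids, outside [s p], all the sets
    [s q] and all earlier edges, which contain at most [#|P| * k] vertices each in total. Avoiding
    the sets [s q] still to be treated keeps later steps from creating new intersections. *)
Lemma rich_expand k (P : finType) (s : P -> {fset V}) :
  (forall e, E e -> #|` e| = k) -> (forall p, rich (s p)) -> (forall p, #|` s p| <= k) ->
  2 * #|P| * k <= L ->
  exists e : P -> {fset V}, (forall p, E (e p) /\ (s p `<=` e p)%fset) /\
    forall p q x, p != q -> x \in e p -> x \in e q -> x \in s p /\ x \in s q.
Proof.
move=> Ek s_rich sk kL.
suff ex (ps : seq P) : size ps <= #|P| -> exists e : P -> {fset V},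
    [/\ forall p, p \in ps -> E (e p) /\ (s p `<=` e p)%fset,
        forall p q x, p \in ps -> x \in e p -> x \in s q -> x \in s p &
        forall p q x, p \in ps -> q \in ps -> p != q -> x \in e p -> x \in e q ->
          x \in s p /\ x \in s q].
  have [|e [eE _ eI]] := ex (enum P); first by rewrite cardE.
  by exists e; split=> [p|p q x]; [apply: eE|apply: eI]; rewrite mem_enum.
elim: ps => [_|p ps IH pP]; first by exists (fun=> fset0); split.
have [e [eE es eI]] := IH (ltnW pP).
have [p_ps|p_ps] := boolP (p \in ps).
  have sub q : q \in p :: ps -> q \in ps by rewrite inE => /orP[/eqP->|].
  exists e; split=> [q /sub|q q' x /sub|q q' x /sub qs /sub]; [exact: eE|exact: es|exact: eI].
pose F := [seq x <- flatten [seq enum_fset (s q) | q <- enum P] ++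
                    flatten [seq enum_fset (e q) | q <- ps] | x \notin s p].
have FL : size F <= L.
  rewrite size_filter; apply: leq_trans (count_size _ _) _; apply: leq_trans kL.
  rewrite size_cat mul2n -addnn mulnDl leq_add //.
    apply: leq_trans (size_flatten_leq (k := k) _) _; last by rewrite size_map -cardE.
    by apply/allP => _ /mapP[q _ ->]; exact: sk.
  apply: leq_trans (size_flatten_leq (k := k) _) _; last by rewrite size_map leq_mul2r ltnW ?orbT.
  by apply/allP => _ /mapP[q qs ->]; rewrite -(Ek _ (eE q qs).1).
have [|e0 [Ee0 se0 Fe0]] := s_rich p F FL.
  by move=> x; rewrite mem_filter => /andP[].
have e0s q x : x \in e0 -> x \in s q -> x \in s p.
  move=> xe0 xs; apply: contraLR xe0 => xp; apply: Fe0; rewrite mem_filter xp mem_cat.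
  apply/orP; left; apply/flattenP; exists (enum_fset (s q)) => //.
  by apply: (map_f (fun q => enum_fset (s q))); rewrite mem_enum.
have e0e q x : q \in ps -> x \in e0 -> x \in e q -> x \in s p.
  move=> qs xe0 xe; apply: contraLR xe0 => xp; apply: Fe0; rewrite mem_filter xp mem_cat.
  apply/orP; right; apply/flattenP; exists (enum_fset (e q)) => //.
  exact: (map_f (fun q => enum_fset (e q))).
exists (fun q => if q == p then e0 else e q); split=> [q|q q' x|q q' x].
- by rewrite inE; case: eqP => //= [-> _|_ /eE].
- by rewrite inE; case: eqP => /= [-> _|_ qs]; [exact: e0s|exact: es].
- rewrite !inE; case: eqP => /= [->|_]; case: eqP => /= [->|_]; rewrite ?eqxx //.
  + move=> _ q's _ xe0 xe; have xp := e0e _ _ q's xe0 xe; split=> //; exact: es xe xp.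
  + move=> qs _ _ xe xe0; have xp := e0e _ _ qs xe0 xe; split=> //; exact: es xe xp.
  + exact: eI.
Qed.

(** The edges over the rich sets meet only inside these sets, so [a], [b] and the intersection
    pattern survive. *)
Lemma bip_exp_rich k j n : (forall e, E e -> #|` e| = k) -> j <= k ->
  2 * (n * n) * k <= L ->
  bip_exp n [set s | #|` s| = j /\ rich s] -> bip_exp n E.
Proof.
move=> Ek jk kL [a [b [g [gP gI]]]].
have [|||e [eE eI]] := @rich_expand k ('I_n * 'I_n)%type (fun p => g p.1 p.2) Ek.
- by move=> [i i']; have [[]] := gP i i'.
- by move=> [i i']; have [[/= ->]] := gP i i'.
- by rewrite card_prod card_ord.
exists a, b, (fun i i' => e (i, i')); split=> [i j'|i j1 i' j2 x xe xe'].
  have [_ ag bg ab] := gP i j'; have [Ee /fsubsetP sub] := eE (i, j').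
  by split=> //; apply: sub.
have [[-> ->]|ne] := eqVneq (i, j1) (i', j2); first by constructor 1.
by have [xs xs'] := eI _ _ _ ne xe xe'; exact: gI xs xs'.
Qed.

End Rich.

(** Each entry of [l] accounts for at most one index. *)
Lemma card_le_hitting (J : finType) (V : choiceType) (S : {set J}) (Z : J -> {fset V})
    (l : seq V) :
  (forall j, j \in S -> exists2 z, z \in l & z \in Z j) ->
  (forall j j' z, z \in l -> z \in Z j -> z \in Z j' -> j = j') -> #|S| <= size l.
Proof.
elim: l S => [|z l IH] S hit disj.
  rewrite leqn0; apply/eqP; apply: eq_card0 => j; apply/negP => /hit[z]; by rewrite in_nil.
rewrite -(cardsID [set j | z \in Z j]%SET S) /= -add1n leq_add //.
  apply/card_le1_eqP => j j'; rewrite !inE => /andP[_ zj] /andP[_ zj'].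
  exact: (disj _ _ _ (mem_head z l) zj' zj).
apply: IH => [j|j j' u ul]; last by apply: disj; rewrite inE ul orbT.
rewrite !inE => /andP[nzj /hit[u + uj]]; rewrite inE => /orP[/eqP uz|ul]; last by exists u.
by rewrite -uz uj in nzj.
Qed.

(** This amounts to saying that no two-element set is [rich]. *)
Definition locally_hit (V : choiceType) (E : set {fset V}) L := forall x y, x != y ->
  exists l : seq V, [/\ size l <= L, forall z, z \in l -> z != x /\ z != y &
    forall e, E e -> x \in e -> y \in e -> exists2 z, z \in l & z \in e].

Lemma card_star_le (J : finType) (V : choiceType) (E : set {fset V}) L (S : {set J})
    (Z : J -> {fset V}) x y :
  locally_hit E L -> (forall j, [/\ x \notin Z j & y \in Z j]) ->
  (forall j, j \in S -> E (x |` Z j)%fset) ->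
  (forall j j' z, z \in Z j -> z \in Z j' -> j = j' \/ z = y) -> #|S| <= L.
Proof.
move=> hit Zxy ZE ZI; have [->|/set0Pn[j0 _]] := eqVneq S finset.set0; first by rewrite cards0.
have xy : x != y by have [nx] := Zxy j0; apply: contraTneq => <-.
have [l [lL lxy lE]] := hit x y xy; apply: leq_trans lL.
apply: (card_le_hitting (Z := Z)) => [j jS|j j' z /lxy[_ /eqP zy] zj /(ZI _ _ _ zj)[]//].
have [_ yj] := Zxy j.
have [||z zl] := lE _ (ZE j jS); rewrite ?inE ?eqxx ?yj ?orbT //.
by have [/negbTE-> _] := lxy z zl; exists z.
Qed.

(** Labels lie in [A] and traces avoid [A], so a label added to one trace never lies in another; on
    a rainbow subgrid the added labels are also distinct. *)
Lemma bip_exp_trace (V : choiceType) (E T : set {fset V}) (A : set V) L n :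
  (forall t, T t -> (forall y, y \in t -> ~ A y) /\ exists2 x, A x & E (x |` t)%fset) ->
  locally_hit E L -> (forall m, bip_exp m T) -> bip_exp n E.
Proof.
move=> TP hit Tbip; have [m [M grid]] := ex_rainbow_grid n L.
(* A square grid of side [m + M] contains the [m] by [M] grid: rows from the first [m] indices,
   columns from the last [M]. *)
have [a [b [g [gP gI]]]] := Tbip (m + M)%N.
have Tg i j : T (g i j) by have [] := gP i j.
have ex_top i j : exists x, A x /\ E (x |` g i j)%fset.
  by have [_ [x]] := TP _ (Tg i j); exists x.
pose top i j := sval (cid (ex_top i j)).
have topP i j : A (top i j) /\ E (top i j |` g i j)%fset by rewrite /top; case: cid.
have top_g i j i' j' : top i j \notin g i' j'.
  by apply/negP => /((TP _ (Tg i' j')).1); apply; exact: (topP i j).1.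
pose la (i : 'I_m) := lshift M i; pose rb (j : 'I_M) := rshift m j.
have la_inj : injective la := @lshift_inj _ _.
have rb_inj : injective rb := @rshift_inj _ _.
have [i x|j x|f [h fh]] := grid _ (fun i j => top (la i) (rb j)).
- set S := finset _; have [->|/set0Pn[j0]] := eqVneq S finset.set0; first by rewrite cards0.
  rewrite inE => /eqP xE.
  apply: (card_star_le (x := x) (Z := fun j => g (la i) (rb j)) (y := a (la i)) hit)
    => [j|j|j j' z zj zj'].
  + by split; [rewrite -xE; exact: top_g|have [] := gP (la i) (rb j)].
  + by rewrite inE => /eqP <-; exact: (topP _ _).2.
  + by have [[_ /rb_inj]|[]|[/rb_inj]] := gI _ _ _ _ _ zj zj'; [left|right|left].
- set S := finset _; have [->|/set0Pn[i0]] := eqVneq S finset.set0; first by rewrite cards0.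
  rewrite inE => /eqP xE.
  apply: (card_star_le (x := x) (Z := fun i => g (la i) (rb j)) (y := b (rb j)) hit)
    => [i|i|i i' z zi zi'].
  + by split; [rewrite -xE; exact: top_g|have [] := gP (la i) (rb j)].
  + by rewrite inE => /eqP <-; exact: (topP _ _).2.
  + by have [[/la_inj]|[/la_inj]|[]] := gI _ _ _ _ _ zi zi'; [left|left|right].
have f_inj i i' : f i = f i' -> i = i' by move=> ff; have [] := fh i i i' i; rewrite ?ff.
have h_inj j j' : h j = h j' -> j = j' by move=> hh; have [] := fh j j j j'; rewrite ?hh.
exists (a \o la \o f), (b \o rb \o h),
  (fun i j => top (la (f i)) (rb (h j)) |` g (la (f i)) (rb (h j)))%fset.
split=> [i j|i j i' j' x].
  have [Tt ag bg ab] := gP (la (f i)) (rb (h j)); split=> //.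
  - exact: (topP _ _).2.
  - by rewrite !inE ag orbT.
  - by rewrite !inE bg orbT.
rewrite !inE => /orP[/eqP->|xg] /orP[|xg'].
- by move=> /eqP/fh; constructor 1.
- by rewrite (negbTE (top_g _ _ _ _)) in xg'.
- by move=> /eqP xE; rewrite xE (negbTE (top_g _ _ _ _)) in xg.
- have [[/la_inj/f_inj ? /rb_inj/h_inj ?]|[/la_inj/f_inj ? ?]|[/rb_inj/h_inj ? ?]] :=
    gI _ _ _ _ _ xg xg'; by [constructor 1|constructor 2|constructor 3].
Qed.

(** * The induction on the uniformity *)

Lemma bip_exp0 (V : choiceType) (E : set {fset V}) : bip_exp 0 E.
Proof.
have a : 'I_0 -> V by case.
by exists a, a, (fun _ _ => fset0); split; case.
Qed.

Lemma ex_neq_fset (V : choiceType) (e : {fset V}) : 1 < #|` e| ->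
  exists x y, [/\ x \in e, y \in e & x != y].
Proof.
move=> e1; have [x xe] : exists x, x \in e by apply/fset0Pn; rewrite -cardfs_gt0 ltnW.
have [y] : exists y, y \in (e `\ x)%fset.
  by apply/fset0Pn; rewrite -cardfs_gt0; move: e1; rewrite (cardfsD1 x) xe.
by rewrite !inE => /andP[yx ye]; exists x, y; rewrite eq_sym.
Qed.

Section Poor.
Variables (V : choiceType) (E : set {fset V}) (k L : nat).
Hypothesis k2 : 2 < k.
Hypothesis Ek : forall e, E e -> #|` e| = k.

Definition poor_edges : set {fset V} := [set e | E e /\
  forall s : {fset V}, (s `<=` e)%fset -> 2 <= #|` s| < k -> ~ rich E L s].

(** A pair inside a poor edge is not rich because [2 < k]; for any other pair the empty list will
    do. *)
Lemma poor_edges_locally_hit : locally_hit poor_edges L.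
Proof.
move=> x y xy.
have [[e [[Ee pe] xe ye]]|no] :=
  pselect (exists e, [/\ poor_edges e, x \in e & y \in e]); last first.
  by exists [::]; split=> // e He xe ye; case: no; exists e.
have /not_rich[F [FL Fxy Fhit]] : ~ rich E L [fset x; y].
  apply: pe; last by rewrite cardfs2 xy.
  by apply/fsubsetP => z; rewrite !inE => /orP[]/eqP->.
exists F; split=> // [z /Fxy|e' [Ee' _] xe' ye']; first by rewrite !inE negb_or => /andP.
by apply: Fhit => //; apply/fsubsetP => z; rewrite !inE => /orP[]/eqP->.
Qed.

Lemma poor_edges_colourable n :
  (forall T : set {fset V}, (forall t, T t -> #|` t| = k.-1) ->
     (exists m, ~ bip_exp m T) -> nat_colourable T) ->
  ~ bip_exp n poor_edges -> nat_colourable poor_edges.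
Proof.
move=> IH nbip.
have ex_hit s : exists F : seq V, ~ rich E L s ->
    [/\ size F <= L, forall x, x \in F -> x \notin s &
      forall e, E e -> (s `<=` e)%fset -> exists2 x, x \in F & x \in e].
  have [rs|/not_rich[F FP]] := pselect (rich E L s); first by exists [::].
  by exists F.
pose F s := sval (cid (ex_hit s)).
suff : nat_colourable [set e | poor_edges e /\ forall x, x \in e -> [set: V] x].
  by apply: nat_colourable_refine => e He; exists e.
apply: (filtration_induction (F := F)
    (Good := fun W => nat_colourable [set e | poor_edges e /\ forall x, x \in e -> W x])).
  move=> W /countable_injP[h h_inj]; exists h => e [[Ee _] eW] [m hm].
  have [|x [y [xe ye]]] := @ex_neq_fset _ e; first by rewrite Ek // ltnW.
  by rewrite (h_inj x y) ?eqxx ?hm //; apply/mem_set/eW.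
move=> lt W rho lt_wo rho_closed rho_good; have [wf tr tri] := lt_wo.
pose low v := [set x | W x /\ lt (rho x) v].
(* Traces range over the whole complement of [low v], which contains the layer [v]. *)
pose T v := [set t : {fset V} | (forall y, y \in t -> ~ low v y) /\
  exists2 x, low v x & poor_edges (x |` t)%fset].
have T_col v : nat_colourable (T v).
  apply: IH => [t [tv [x xv [/Ek + _]]]|].
    have xt : x \notin t by apply/negP => /tv.
    by rewrite cardfsU1 xt add1n => <-.
  apply/existsNP => Tbip; apply: nbip.
  by apply: (bip_exp_trace (A := low v) n _ poor_edges_locally_hit Tbip).
have top_col v : exists c : V -> nat, (exists2 i, W i & rho i = v) ->
    forall e, poor_edges e -> (forall x, x \in e -> W x /\ ~ lt v (rho x)) ->
    ~ monochromatic c [set` e].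
  have [[i Wi <-]|] := pselect (exists2 i, W i & rho i = v); last by exists (fun=> 0).
  by have [c cP] := rho_good i Wi; exists c => _ e pe eW; apply: cP.
pose a v := sval (cid (top_col v)); pose b v := sval (cid (T_col v)).
(* The first component is for edges inside their top layer, the second for edges with exactly one
   vertex below it. *)
exists (fun x => choice.pickle (a (rho x) x, b (rho x) x)) => e [pe eW] mono.
have ek : #|` e| = k by exact: Ek pe.1.
have [y ye] : exists y, y \in e by apply/fset0Pn; rewrite -cardfs_gt0 ek (ltn_trans _ k2).
have [m me mmax] := strict_well_order_max rho lt_wo ye.
pose s := [fset x in e | `[< lt (rho x) (rho m) >]]%fset.
have sP x : x \in s <-> x \in e /\ lt (rho x) (rho m).
  by rewrite !inE; split=> [/andP[-> /asboolP]|[-> /asboolP]].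
have rhoE x : x \in e -> x \notin s -> rho x = rho m.
  move=> xe xs; case: (tri (rho x) (rho m)) => [xm|//|/mmax]; last by case/(_ xe).
  by case/negP: xs; apply/sP.
have se : (s `<=` e)%fset by apply/fsubsetP => x /sP[].
have mono_on (t : {fset V}) : {subset t <= e} -> (forall x, x \in t -> x \notin s) ->
    monochromatic (a (rho m)) [set` t] /\ monochromatic (b (rho m)) [set` t].
  move=> te ts; apply: monochromatic_code; case: mono => q mono; exists q => x xt.
  by rewrite -(mono x (te x xt)) rhoE ?te ?ts.
have [s0|s0] := eqVneq s fset0.
  have [||mono_a _] := mono_on e => //; first by move=> x _; rewrite s0 inE.
  move: mono_a; rewrite /a; case: cid => c /= cP; apply: cP => //.
    by exists m => //; exact: eW.
  by move=> x xe; split; [exact: eW|exact: mmax].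
have [/eqP/cardfs1P[x sx]|s1] := eqVneq #|` s| 1.
  have [xe xm] : x \in e /\ lt (rho x) (rho m) by apply/sP; rewrite sx inE.
  have [||_] := mono_on (e `\ x)%fset.
  - by move=> z; rewrite !inE => /andP[].
  - by move=> z; rewrite sx !inE => /andP[].
  rewrite /b; case: cid => c /= cP; apply: cP; split.
    move=> z; rewrite !inE => /andP[zx ze] [_ zm].
    by have : z \in s by [exact/sP]; rewrite sx inE (negbTE zx).
  by exists x; [split=> //; exact: eW|rewrite fsetD1K].
(* The remaining case is impossible: [s] misses [m] and has at least two elements, so it is not rich
   and [e] meets [F s] outside [s]; but closedness puts that point below the top layer, hence in
   [s]. *)
have sk : #|` s| < k.
  rewrite -ek; apply: fproper_ltn_card; rewrite fproperE se /=.
  apply/negP => /fsubsetP/(_ m me)/sP[_]; exact: strict_well_order_irr.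
have s2 : 1 < #|` s| by rewrite ltn_neqAle eq_sym s1 cardfs_gt0.
have ns : ~ rich E L s by apply: pe.2 => //; rewrite s2.
have Fs : [/\ size (F s) <= L, forall x, x \in F s -> x \notin s &
   forall e, E e -> (s `<=` e)%fset -> exists2 x, x \in F s & x \in e].
  by rewrite /F; case: cid => l /=; exact.
have [_ Fns Fhit] := Fs; have [z zF ze] := Fhit e pe.1 se.
have /negP := Fns z zF; apply; apply/sP; split=> //.
have [u us] : exists u, u \in s by exact/fset0Pn.
suff [] : low (rho m) z by [].
by apply: (rho_closed (rho m) s u us _ z zF) => w /sP[we wm]; split=> //; exact: eW.
Qed.

End Poor.

(** Every edge either contains a rich set of size between 2 and [k - 1] or is poor. The rich sets
    are coloured one size at a time, each size being a uniform hypergraph covered by the induction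
    hypothesis. *)
Lemma nat_colourable_or_bip_exp (V : choiceType) k n (E : set {fset V}) :
  2 <= k -> 1 <= n -> (forall e, E e -> #|` e| = k) -> ~ bip_exp n E ->
  nat_colourable E.
Proof.
elim/ltn_ind: k n E => k IH n E k2 n1 Ek nbip.
have [kE|k_neq2] := eqVneq k 2; first by apply: graph_colourable n1 => // e; rewrite -kE; exact: Ek.
have k3 : 2 < k by rewrite ltn_neqAle eq_sym k_neq2.
(* The bound of [rich_expand] for a family indexed by the [n * n] cells of the grid. *)
pose L := (2 * (n * n) * k)%N.
pose R m := [set s | [/\ 2 <= #|` s|, #|` s| < m & rich E L s]].
have R_col m : m <= k -> nat_colourable (R m).
  elim: m => [_|m IHm mk]; first by exists (fun=> 0) => e [].
  have [m1|m2] := leqP m 1.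
    by exists (fun=> 0) => e [e2 + _]; rewrite ltnS => em; have := leq_trans e2 (leq_trans em m1).
  apply: (@nat_colourable_refine _ _ (R m `|` [set s | #|` s| = m /\ rich E L s])).
    move=> e [e2 em re]; exists e => //.
    by move: em; rewrite ltnS leq_eqVlt => /orP[/eqP|]; [right|left].
  apply: nat_colourableU; first exact: IHm (ltnW mk).
  apply: (IH m mk n) => // [e []//|/bip_exp_rich -/(_ _ Ek)].
  by move=> /(_ (ltnW mk) (leqnn _)).
have poor_col : nat_colourable (poor_edges E k L).
  apply: (@poor_edges_colourable _ _ _ _ k3 Ek n) => [T Tk [m nT]|].
    (* The induction hypothesis needs a positive grid size; size 0 cannot be excluded since
       [bip_exp 0] always holds. *)
    case: m nT => [/(_ (bip_exp0 _))//|m nT]; have k0 : 0 < k by exact: ltnW.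
    by apply: (IH k.-1 _ m.+1) => //; rewrite -ltnS prednK.
  move=> [a [b [g [gP gI]]]]; apply: nbip; exists a, b, g; split=> // i j.
  by have [[]] := gP i j.
apply: nat_colourable_refine (nat_colourableU (R_col k (leqnn k)) poor_col) => e Ee.
have [[s [sR se]]|no] := pselect (exists s, R k s /\ (s `<=` e)%fset).
  by exists s => //; left.
exists e => //; right; split=> // s se /andP[s2 sk] rs; apply: no.
by exists s.
Qed.

(** * Embedding expansions *)

Lemma ex_edge_ends n : exists p : edge (complete_bipartite n) -> 'I_n * 'I_n,
  injective p /\ forall e, set_val e = [set inl (p e).1; inr (p e).2].
Proof.
have endsP (e : edge (complete_bipartite n)) : exists p : 'I_n * 'I_n,
    set_val e = [set inl p.1; inr p.2].
  by have [i [j eE]] := set_valP e; exists (i, j).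
pose p e := sval (cid (endsP e)).
have pP e : set_val e = [set inl (p e).1; inr (p e).2] by rewrite /p; case: cid.
by exists p; split=> // e e' pe; apply: set_val_inj; rewrite !pP pe.
Qed.

Lemma finite_expansion_bipartite k n :
  finite_set [set: vertex (expansion k (complete_bipartite n))].
Proof.
have [p [p_inj _]] := ex_edge_ends n.
pose f (x : expansion_vertex k (complete_bipartite n)) :
    (('I_n + 'I_n) + ('I_n * 'I_n) * 'I_(k - 2))%type :=
  match x with inl v => inl v | inr (e, l) => inr (p e, l) end.
have f_inj : injective f by move=> [v|[e l]] [v'|[e' l']] //= [] => [->|/p_inj-> ->].
exact: card_le_finite (inj_card_leT f_inj) finite_finset.
Qed.

(** The new vertices of the cell [(i, j)] go to an enumeration of the [k - 2] elements of [g i j]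
    other than [a i] and [b j]. *)
Lemma bip_exp_subhypergraph (H : hypergraph) (k n : nat)
    (E : set {fset {classic (vertex H)}}) :
  1 <= n -> (forall e, E e -> #|` e| = k) -> (forall e, E e -> edge H [set` e]) ->
  bip_exp n E -> has_subhypergraph (expansion k (complete_bipartite n)) H.
Proof.
(* [i0] is an arbitrary partner: it places a single [a i] or [b j] in some edge, where the
   intersection pattern applies. *)
move=> n1 Ek EH [a [b [g [gP gI]]]]; pose i0 := Ordinal n1.
have ag i j : a i \in g i j by have [] := gP i j.
have bg i j : b j \in g i j by have [] := gP i j.
have ab i j : a i != b j by have [] := gP i j.
have a_only i i' j : a i' \in g i j -> i' = i.
  move=> ai; have [[]|[]|[_ e]] // := gI _ _ _ _ _ ai (ag i' j).
  by have := ab i' j; rewrite e eqxx.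
have b_only i j j' : b j' \in g i j -> j' = j.
  move=> bj; have [[]|[_ e]|[]] // := gI _ _ _ _ _ bj (bg i j').
  by have := ab i j'; rewrite e eqxx.
have exh i j : exists h : 'I_(k - 2) -> {classic (vertex H)}, [/\ injective h,
    forall l, [/\ h l \in g i j, h l <> a i & h l <> b j] &
    forall x, x \in g i j -> [\/ x = a i, x = b j | exists l, h l = x]].
  have [|h [h_inj hg h_surj]] := @ex_enum_uniq _ (g i j `\ a i `\ b j)%fset (k - 2) (fset_uniq _).
    have [/Ek <- _ _ _] := gP i j.
    by rewrite (cardfsD1 (a i)) ag (cardfsD1 (b j)) !inE bg eq_sym ab subn2.
  exists h; split=> // [l|x xg].
    by have := hg l; rewrite !inE => /and3P[/eqP hb /eqP ha].
  have [->|xa] := eqVneq x (a i); first by constructor 1.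
  have [->|xb] := eqVneq x (b j); first by constructor 2.
  by constructor 3; apply: h_surj; rewrite !inE xa xb.
pose h i j := sval (cid (exh i j)).
have hP i j : [/\ injective (h i j),
    forall l, [/\ h i j l \in g i j, h i j l <> a i & h i j l <> b j] &
    forall x, x \in g i j -> [\/ x = a i, x = b j | exists l, h i j l = x]].
  by rewrite /h; case: cid.
have [p [p_inj pP]] := ex_edge_ends n.
pose f (x : expansion_vertex k (complete_bipartite n)) : vertex H :=
  match x with
  | inl (inl i) => a i
  | inl (inr j) => b j
  | inr (e, l) => h (p e).1 (p e).2 l
  end.
(* The image of a new vertex lies in no edge of the grid but its own. *)
have new_ends e l i j : h (p e).1 (p e).2 l \in g i j ->
    (p e).1 = i /\ (p e).2 = j.
  have [_ /(_ l)[hg ha hb] _] := hP (p e).1 (p e).2.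
  by move=> /(gI _ _ _ _ _ hg)[|[_ /ha]|[_ /hb]].
have new_a e l i : h (p e).1 (p e).2 l <> a i.
  move=> he; have [_ /(_ l)[_ + _] _] := hP (p e).1 (p e).2; apply.
  by have [|pi _] := new_ends e l i i0; rewrite he ?pi.
have new_b e l j : h (p e).1 (p e).2 l <> b j.
  move=> he; have [_ /(_ l)[_ _ +] _] := hP (p e).1 (p e).2; apply.
  by have [|_ pj] := new_ends e l i0 j; rewrite he ?pj.
exists f.
  move=> [[i|j]|[e l]] [[i'|j']|[e' l']] /= ff.
  - by rewrite (a_only i' i i0) // ff.
  - by have := ab i j'; rewrite ff eqxx.
  - by case: (new_a e' l' i).
  - by have := ab i' j; rewrite ff eqxx.
  - by rewrite (b_only i0 j' j) // ff.
  - by case: (new_b e' l' j).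
  - by case: (new_a e l i').
  - by case: (new_b e l j').
  - have [_ /(_ l')[hg' _ _] _] := hP (p e').1 (p e').2.
    have [|p1 p2] := new_ends e l (p e').1 (p e').2; first by rewrite ff.
    have ee' : e = e' by apply: p_inj; rewrite [p e]surjective_pairing p1 p2 -surjective_pairing.
    rewrite -ee' in ff *.
    by have [h_inj _ _] := hP (p e).1 (p e).2; rewrite (h_inj _ _ ff).
move=> _ [e _ <-].
suff -> : f @` expansion_edge e = [set` g (p e).1 (p e).2].
  by apply: EH; have [] := gP (p e).1 (p e).2.
have [_ hg h_surj] := hP (p e).1 (p e).2.
apply/seteqP; split=> [_ [x ex <-]|x /h_surj[->|->|[l <-]]].
- case: x ex => [[i|j]|[e' l]].
  + move=> /expansion_edge_base; rewrite pP => -[[->]|//]; exact: ag.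
  + move=> /expansion_edge_base; rewrite pP => -[//|[->]]; exact: bg.
  + by move=> /expansion_edge_new->; have [] := hg l.
- by exists (inl (inl (p e).1)) => //; apply/expansion_edge_base; rewrite pP; left.
- by exists (inl (inr (p e).2)) => //; apply/expansion_edge_base; rewrite pP; right.
- by exists (inr (e, l)) => //; apply/expansion_edge_new.
Qed.

Lemma aleph1_chromatic_not_nat_colourable k (H : hypergraph) : 2 <= k -> uniform k H ->
  [set: aleph1] #<= [set: chromatic_number H] -> ~ colourable H nat.
Proof.
move=> k2 Hk chi Hnat; apply: aleph1P.1; apply: sub_countable (countableP [set: nat]).
by apply: card_le_trans chi _; have [_] := chromatic_numberP k2 Hk; apply.
Qed.

Theorem theorem1p2 (k n : nat) (hk : (2 <= k)%N) (hn : (1 <= n)%N) :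
  obligatory k (expansion k (complete_bipartite n)).
Proof.
split.
- exact: finite_expansion_bipartite.
- exact: expansion_uniform hk (@complete_bipartite_uniform n).
move=> H Hk /(aleph1_chromatic_not_nat_colourable hk Hk) H_col.
pose V := {classic (vertex H)}; pose E : set {fset V} := [set e : {fset V} | edge H [set` e]].
have Ek e : E e -> #|` e| = k.
  by move=> /Hk ek; rewrite -(set_fsetK e); exact: (card_fset_set (A := [set` e] : set V) ek).
apply: (@bip_exp_subhypergraph H k n E) => //.
(* Without a grid the finite-set version [E] of the edges would be countably colourable, and hence
   so would [H]. *)
apply: contrapT => /(nat_colourable_or_bip_exp hk hn Ek)[c cP]; apply: H_col.
exists c => e eH.
have fin_e : finite_set (e : set V) by exists k; exact: Hk eH.
have := cP (fset_set (e : set V)); rewrite /E /= fset_setK //; apply.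
exact: eH.
Qed.
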